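(* Let $\Omega$ be a bounded domain in $\mathbb{R}^N$, $N\ge 1$, let $\beta\ge 0$, and let $q>1$ with $q+1\le 2N/(N-2)$ if $N\ge 3$. Assume that $u,v\in H^1_0(\Omega)$ solve $$-\Delta u=|x|^{\beta}|v|^{q-1}v,\qquad -\Delta v=|x|^{\beta}|u|^{q-1}u\quad\text{in }\Omega,\qquad u=v=0\ \text{on }\partial\Omega.$$ Then $u=v$.
   Context: Solutions in $H^1_0(\Omega)$ are understood in the weak sense. *)

(* Defs.v *)
From HB Require Import structures.
From mathcomp Require Import all_boot all_order all_algebra.
From mathcomp Require Import all_classical all_reals all_analysis.

Set Implicit Arguments.
Unset Strict Implicit.
Unset Printing Implicit Defensive.
Import Order.TTheory GRing.Theory Num.Theory.
Import numFieldNormedType.Exports.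
Local Open Scope classical_set_scope.
Local Open Scope ring_scope.

(* 'rV[R]_n carries the product (= Borel) sigma-algebra, generated by the
   coordinates, as the library does for n.-tuple R *)
Section rV_measurable.
Context {R : realType} {n : nat}.

Let coors : 'I_n -> 'rV[R]_n -> R := fun i x => x ord0 i.

Let rV_set0 : g_sigma_preimage coors set0.
Proof. exact: sigma_algebra0. Qed.

Let rV_setC A : g_sigma_preimage coors A -> g_sigma_preimage coors (~` A).
Proof. exact: sigma_algebraC. Qed.

Let rV_bigcup (F : (set 'rV[R]_n)^nat) :
  (forall i, g_sigma_preimage coors (F i)) ->
  g_sigma_preimage coors (\bigcup_i (F i)).
Proof. exact: sigma_algebra_bigcup. Qed.

HB.instance Definition _ := @isMeasurable.Build default_measure_display
  'rV[R]_n (g_sigma_preimage coors) rV_set0 rV_setC rV_bigcup.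

Lemma measurable_coord (i : 'I_n) :
  measurable_fun [set: 'rV[R]_n] (fun x : 'rV[R]_n => x ord0 i).
Proof.
move=> _ Y mY; rewrite setTI; apply: sub_sigma_algebra => /=.
rewrite -bigcup_seq/=; exists i => /=; first by rewrite mem_index_enum.
by exists Y => //; rewrite setTI.
Qed.

Lemma measurable_fun_rV d (T : measurableType d) (f : T -> 'rV[R]_n) :
  (forall i, measurable_fun [set: T] (fun x => f x ord0 i)) ->
  measurable_fun [set: T] f.
Proof.
move=> mf; suff mfS : g_sigma_preimage (fun i => coors i \o f) `<=` measurable.
  by move=> _ A mA; apply: mfS; rewrite g_sigma_preimage_comp; exists A.
apply: smallest_sub; first exact: sigma_algebra_measurable.
rewrite -bigcup_seq => A [i _ [B mB <-]]; exact: mf.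
Qed.

End rV_measurable.

Section lebesgue_rV_step.
Context {R : realType} {n : nat}.

Definition rV_cons (p : measurableTypeR R * 'rV[R]_n) : 'rV[R]_n.+1 :=
  row_mx (p.1)%:M p.2.

Lemma rV_cons0 p : rV_cons p ord0 ord0 = p.1.
Proof. by rewrite /rV_cons mxE split1 unlift_none /= mxE mulr1n. Qed.

Lemma rV_consS p i : rV_cons p ord0 (lift ord0 i) = p.2 ord0 i.
Proof. by rewrite /rV_cons mxE split1 liftK. Qed.

Lemma measurable_rV_cons : measurable_fun setT rV_cons.
Proof.
apply: measurable_fun_rV => i; case: (unliftP ord0 i) => [j|] ->.
  under eq_fun do rewrite rV_consS.
  exact: (measurableT_comp (@measurable_coord R n j) measurable_snd).
by under eq_fun do rewrite rV_cons0; exact: measurable_fst.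
Qed.

HB.instance Definition _ := isMeasurableFun.Build _ _ _ _ rV_cons
  measurable_rV_cons.

Variable mu : {sigma_finite_measure set 'rV[R]_n -> \bar R}.

Definition lebesgue_rVS : set 'rV[R]_n.+1 -> \bar R :=
  pushforward (lebesgue_measure \x mu)%E rV_cons.

Let rVS_pre (A : set 'rV[R]_n.+1) :
  measurable A -> measurable (rV_cons @^-1` A).
Proof.
by move=> mA; rewrite -[X in measurable X]setTI; exact: measurable_rV_cons.
Qed.

Let rVS0 : lebesgue_rVS set0 = 0%E.
Proof. by rewrite /lebesgue_rVS /pushforward preimage_set0 measure0. Qed.

Let rVS_ge0 A : (0 <= lebesgue_rVS A)%E.
Proof. exact: measure_ge0. Qed.

Let rVS_sigma_additive : semi_sigma_additive lebesgue_rVS.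
Proof.
move=> F mF tF mUF; rewrite /lebesgue_rVS /pushforward preimage_bigcup.
apply: measure_semi_sigma_additive.
- by move=> k; exact: rVS_pre.
- apply/trivIsetP => /= i j _ _ ij; rewrite -preimage_setI.
  by move/trivIsetP : tF => /(_ _ _ _ _ ij) ->//; rewrite preimage_set0.
- by rewrite -preimage_bigcup; exact: rVS_pre.
Qed.

HB.instance Definition _ := isMeasure.Build _ _ _ lebesgue_rVS
  rVS0 rVS_ge0 rVS_sigma_additive.

Let rVS_sigma_finite : sigma_finite setT lebesgue_rVS.
Proof.
have /sigma_finiteP[F [FT ndF Foo]] := sigma_finiteT (@lebesgue_measure R).
have /sigma_finiteP[G [GT ndG Goo]] := sigma_finiteT mu.
pose uncons (x : 'rV[R]_n.+1) : measurableTypeR R * 'rV[R]_n :=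
  (x ord0 ord0, \row_i x ord0 (lift ord0 i)).
have consK : cancel rV_cons uncons.
  move=> [a x]; rewrite /uncons rV_cons0; congr pair.
  by apply/rowP => i; rewrite mxE rV_consS.
have munc : measurable_fun setT uncons.
  apply/measurable_fun_pairP; split => /=; first exact: measurable_coord.
  apply: measurable_fun_rV => i /=.
  under eq_fun do rewrite mxE.
  exact: measurable_coord.
exists (fun k => uncons @^-1` (F k `*` G k)).
  rewrite -preimage_bigcup -[LHS](preimage_setT uncons); congr (_ @^-1` _).
  rewrite -setXTT FT GT predeqE => -[x y]; split.
    move=> [/= [k _ Fkx] [l _ Gly]]; exists (maxn k l) => //; split.
    - by move: x Fkx; exact/subsetPset/ndF/leq_maxl.
    - by move: y Gly; exact/subsetPset/ndG/leq_maxr.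
  by move=> [k _ []/= ? ?]; split; exists k.
move=> k; have [mF Fk] := Foo k; have [mG Gk] := Goo k; split.
  rewrite -[X in measurable X]setTI; apply: munc => //; exact: measurableX.
rewrite /lebesgue_rVS /pushforward -comp_preimage.
rewrite (_ : uncons \o rV_cons = id) ?preimage_id; last first.
  by apply/funext => p; exact: consK.
by rewrite product_measure1E// lte_mul_pinfty// ge0_fin_numE.
Qed.

HB.instance Definition _ := Measure_isSigmaFinite.Build _ _ _ lebesgue_rVS
  rVS_sigma_finite.

End lebesgue_rV_step.

Fixpoint lebesgue_rV {R : realType} (n : nat) :
    {sigma_finite_measure set 'rV[R]_n -> \bar R} :=
  match n with
  | 0 => \d_(0 : 'rV[R]_0)
  | m.+1 => lebesgue_rVS (lebesgue_rV m)
  end.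

Lemma lebesgue_rV_box (R : realType) (n : nat)
    (A : 'I_n -> set (measurableTypeR R)) :
  (forall i, measurable (A i)) ->
  lebesgue_rV n [set x : 'rV[R]_n | forall i, A i (x ord0 i)] =
  (\prod_(i < n) lebesgue_measure (A i))%E.
Proof.
elim: n A => [|n IH] A mA.
  by rewrite big_ord0 /= diracE mem_set//= => -[].
rewrite big_ord_recl /= /lebesgue_rVS /pushforward.
rewrite -IH; last by move=> i; exact: mA.
have mB (m : nat) (B : 'I_m -> set (measurableTypeR R)) :
    (forall i, measurable (B i)) ->
    measurable [set x : 'rV[R]_m | forall i, B i (x ord0 i)].
  move=> mB.
  rewrite (_ : mkset _ =
      \bigcap_(i in [set: 'I_m]) (fun x : 'rV[R]_m => x ord0 i) @^-1` B i).
    apply: fin_bigcap_measurable => // i _.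
    by have := @measurable_coord R m i measurableT _ (mB i); rewrite setTI.
  by apply/seteqP; split => [x H i _|x H i]; [exact: H|exact: (H i I)].
have mA0 := mA ord0; have mAS := mB _ _ (fun i => mA (lift ord0 i)).
rewrite -(product_measure1E _ _ mA0 mAS).
congr (_ _); apply/seteqP; split => -[a x] /=.
  move=> H; split => [|i] /=; first by have := H ord0; rewrite rV_cons0.
  by have := H (lift ord0 i); rewrite rV_consS.
move=> [Ha H] i; case: (unliftP ord0 i) => [j|] ->.
  by rewrite rV_consS; exact: H.
by rewrite rV_cons0.
Qed.

Section sobolev.
Context {R : realType} {N : nat}.
Local Notation E := 'rV[R]_N.
Local Notation mu := (@lebesgue_rV R N).
Implicit Types (Omega : set E) (u v w f phi : E -> R) (Du Dw : 'I_N -> E -> R).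

(* the norm of the normed module 'rV[R]_N is the sup norm *)
Definition eucl_norm (x : E) : R := Num.sqrt (\sum_i x ord0 i ^+ 2).

Definition bounded_domain Omega : Prop :=
  [/\ open Omega, connected Omega, Omega !=set0 & bounded_set Omega].

Definition partial (i : 'I_N) u : E -> R := fun x => 'D_(delta_mx ord0 i) u x.

Definition smooth u : Prop := forall s : seq 'I_N,
  let Ds := foldr partial u s in
  continuous Ds /\ forall i x, derivable Ds x (delta_mx ord0 i).

Definition test_function Omega phi : Prop :=
  let supp := closure [set x | phi x != 0] in
  [/\ smooth phi, compact supp & supp `<=` Omega].

Definition in_L2 Omega u : Prop :=
  measurable_fun Omega u /\ (\int[mu]_(x in Omega) (u x ^+ 2)%:E < +oo)%E.

Definition weak_gradient Omega u Du : Prop :=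
  (forall i, in_L2 Omega (Du i)) /\
  (forall i phi, test_function Omega phi ->
    \int[mu]_(x in Omega) (u x * partial i phi x)%:E =
    - \int[mu]_(x in Omega) (Du i x * phi x)%:E)%E.

(* squared H^1 norm of a function u whose weak gradient is Du *)
Definition sqr_H1_norm Omega u Du : \bar R :=
  (\int[mu]_(x in Omega) (u x ^+ 2 + \sum_i Du i x ^+ 2)%:E)%E.

(* the closure of the test functions in H^1(Omega) *)
Definition in_H10 Omega u : Prop :=
  in_L2 Omega u /\
  exists Du, weak_gradient Omega u Du /\
  exists2 phi : nat -> E -> R, (forall n, test_function Omega (phi n)) &
    (fun n => sqr_H1_norm Omega (u \- phi n)
                (fun i => Du i \- partial i (phi n))) @ \oo --> 0%E.

(* u is a weak solution of -Delta u = f in Omega, u = 0 on the boundary. The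
   integrals are compared in \bar R: the left-hand one is finite, so that the
   equation also says that f * w is integrable, since +oo - +oo = -oo there. *)
Definition weak_solution Omega u f : Prop :=
  in_H10 Omega u /\
  forall Du, weak_gradient Omega u Du ->
  forall w Dw, in_H10 Omega w -> weak_gradient Omega w Dw ->
    (\int[mu]_(x in Omega) (\sum_i Du i x * Dw i x)%:E =
     \int[mu]_(x in Omega) (f x * w x)%:E)%E.

End sobolev.

(* Main.v *)
Require Import Defs.
From mathcomp Require Import all_boot all_order all_algebra.
From mathcomp Require Import all_classical all_reals all_analysis.
From mathcomp Require Import measurable_realfun ring lra.
Import Order.TTheory GRing.Theory Num.Theory.
Import numFieldNormedType.Exports.
Local Open Scope classical_set_scope.
Local Open Scope ring_scope.
Set Implicit Arguments.
Unset Strict Implicit.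
Unset Printing Implicit Defensive.

(** Put [w = u - v]. Testing both equations with [w] and subtracting gives
    [int |grad w|^2 = int |x|^beta (|v|^(q-1) v - |u|^(q-1) u) (u - v)],
    whose right-hand side is nonpositive because [t |-> |t|^(q-1) t] is
    nondecreasing ([powR_odd_monotone]). Hence [grad w = 0], and [w = 0] by the
    Poincare inequality ([poincare]). The integrals of the nonlinear terms may
    be subtracted because the weak formulation equates each of them with a
    finite one, which makes the integrands integrable
    ([integrable_fin_integral]).

    The Poincare inequality is derived without Fubini or the fundamental
    theorem of calculus. If test functions [phi_n] approximate [w] in H^1, then
    [x_i phi_n] is again a test function ([test_function_coordM]), and the
    definition of the weak derivative [D_i w] gives
    [int w (phi_n + x_i d_i phi_n) + int D_i w x_i phi_n = 0].
    In the limit, [int w^2 = - 2 int x_i w D_i w], and Young's inequality with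
    [|x_i| <= M] on the bounded set absorbs the factor [w]. Instead of passing
    to the limit in each product, one pointwise inequality
    ([poincare_pointwise]) bounds [w^2] by the integrand of the identity,
    [9 M^2 (D_i w)^2], and a multiple of the squared approximation error. *)

(** * Measurability and boundedness in R^N *)

Section measurability.
Context {R : realType} {N : nat}.
Local Notation E := 'rV[R]_N.
Local Notation mu := (@lebesgue_rV R N).

Lemma box_measurable (A : 'I_N -> set R) :
  (forall i, measurable (A i)) ->
  measurable [set x : E | forall i, A i (x ord0 i)].
Proof.
move=> mA; rewrite (_ : mkset _ =
  \bigcap_(i in [set: 'I_N]) (fun x : E => x ord0 i) @^-1` A i).
  apply: fin_bigcap_measurable => // i _.
  by have := @measurable_coord R N i measurableT _ (mA i); rewrite setTI.
by apply/seteqP; split => [x H i _|x H i]; [exact: H|exact: (H i I)].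
Qed.

(** The sigma-algebra is generated by the coordinates, so an open set has to be
    written as a countable union of products of intervals: those with rational
    centre and radius [1/(k+1)] that it contains. *)
Lemma open_measurable_rV (U : set E) : open U -> measurable U.
Proof.
move=> oU.
pose B (p : 'rV[rat]_N * nat) : set E :=
  [set x | forall i, ball (ratr (p.1 ord0 i) : R) p.2.+1%:R^-1 (x ord0 i)].
rewrite (_ : U = \bigcup_p (if pselect (B p `<=` U) then B p else set0)).
  apply: countable_bigcupT_measurable; first exact: countableP.
  move=> p; case: (pselect (B p `<=` U)) => /= _; last exact: measurable0.
  apply: (box_measurable
    (A := fun i => ball (ratr (p.1 ord0 i) : R) p.2.+1%:R^-1)) => i.
  exact: measurable_ball.
apply/seteqP; split => [x Ux|x [p _]]; last first.
  by case: (pselect (B p `<=` U)) => //= + Bx; apply.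
have /nbhs_ballP[e /= e0 xeU] : nbhs x U by exact: open_nbhs_nbhs.
(* the radius is below e / 2: a box that contains x stays in the e-ball of x *)
have [k ke] : exists k : nat, k.+1%:R^-1 < e / 2.
  have [k _ /(_ _ (leqnn _)) ke] :=
    near_infty_natSinv_lt (PosNum (divr_gt0 e0 (ltr0Sn R 1))).
  by exists k.
have k0 : 0 < k.+1%:R^-1 :> R by rewrite invr_gt0 ltr0n.
have /choice[p pP] : forall i : 'I_N, exists r : rat,
    `|ratr r - x ord0 i| < k.+1%:R^-1.
  move=> i; have xlt : x ord0 i - k.+1%:R^-1 < x ord0 i + k.+1%:R^-1.
    by rewrite ltrBlDr -addrA ltrDl addr_gt0.
  have [r] := rat_in_itvoo xlt.
  by rewrite in_itv/= => rx; exists r; rewrite ltr_distl.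
exists (\row_i p i, k) => //.
case: (pselect (B (\row_i p i, k) `<=` U)) => [?|absurd].
  by move=> i /=; rewrite mxE /ball/= pP.
exfalso; apply: absurd => y By; apply: xeU; split => // i j.
have := By j; rewrite !mxE /ball /= (ord1 i) => yj; have xj := pP j.
apply: le_lt_trans (ler_distD (ratr (p j)) _ _) _.
rewrite (distrC (x _ _)) addrC.
by apply: lt_trans (ltrD yj xj) _; rewrite [ltRHS](splitr e) ltrD.
Qed.

Lemma continuous_measurable_rV (f : E -> R) :
  continuous f -> measurable_fun setT f.
Proof.
move=> cf; apply: (measurability _ (RGenOpens.measurableE R)).
move=> _ [_ [a [b ->] <-]]; rewrite setTI.
apply: open_measurable_rV; apply: open_comp => [x _|]; first exact: cf.
exact: interval_open.
Qed.

Lemma coord_le_norm (x : E) (i : 'I_N) : `|x ord0 i| <= `|x|.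
Proof.
rewrite /Num.norm /= mx_normrE.
exact: (le_bigmax _ (fun ij : 'I_1 * 'I_N => `|x ij.1 ij.2|) (ord0, i)).
Qed.

Lemma bounded_coord (A : set E) : bounded_set A ->
  exists M : R, forall x i, A x -> `|x ord0 i| <= M.
Proof.
move=> [M [_ HM]]; exists (M + 1) => x i Ax.
apply: le_trans (HM (M + 1) _ x Ax); last by rewrite ltrDl.
exact: coord_le_norm.
Qed.

Lemma bounded_measure_lty (A : set E) :
  measurable A -> bounded_set A -> (mu A < +oo)%E.
Proof.
move=> mA /bounded_coord[M HM].
have mB (i : 'I_N) : measurable (`[- M, M]%classic : set R) by [].
apply: (@le_lt_trans _ _
  (mu [set x | forall i : 'I_N, `[- M, M]%classic (x ord0 i)])).
  apply: le_measure; rewrite ?inE//; 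
    first exact: (box_measurable (A := fun=> `[- M, M]%classic)).
  by move=> x Ax i; rewrite /= in_itv/= -ler_norml HM.
rewrite (lebesgue_rV_box (A := fun=> `[- M, M]%classic))//.
rewrite -ge0_fin_numE; last by apply: prode_ge0 => i _; exact: measure_ge0.
apply: (big_ind (fun y : \bar R => y \is a fin_num)) => // [x y ? ?|i _].
  exact: fin_numM.
by rewrite lebesgue_measure_itv /=; case: ifP.
Qed.

End measurability.
(** * Smooth functions and test functions *)

Section test_functions.
Context {R : realType} {N : nat}.
Local Notation E := 'rV[R]_N.
Implicit Types (Omega : set E) (u v phi psi : E -> R) (i j : 'I_N).

Lemma smooth_continuous u : smooth u -> continuous u.
Proof. by move=> su; have [] := su [::]. Qed.

Lemma smooth_derivable u i x : smooth u -> derivable u x (delta_mx ord0 i).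
Proof. by move=> su; have [_] := su [::]; apply. Qed.

Lemma smooth_partial u i : smooth u -> smooth (partial i u).
Proof. by move=> su s; have := su (rcons s i); rewrite foldr_rcons. Qed.

(** Coinduction for smoothness: it suffices to find a class of continuous
    functions with partial derivatives that contains [u] and is stable under
    [partial]. Stability results thus need no Leibniz rule of higher order. *)
Lemma smooth_ind (P : (E -> R) -> Prop) u : P u ->
  (forall v, P v -> [/\ continuous v,
     forall i x, derivable v x (delta_mx ord0 i) &
     forall i, P (partial i v)]) ->
  smooth u.
Proof.
move=> Pu PP s; suff /PP[] : P (foldr partial u s) by [].
by elim: s => //= i s /PP[_ _]; apply.
Qed.

Lemma partialB u v i : smooth u -> smooth v ->
  partial i (u \- v) = partial i u \- partial i v.
Proof.
move=> su sv; apply/funext => x.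
by rewrite /partial deriveB//; exact: smooth_derivable.
Qed.

Lemma smoothB u v : smooth u -> smooth v -> smooth (u \- v).
Proof.
move=> su sv; apply: (@smooth_ind (fun w => exists a b,
  [/\ smooth a, smooth b & w = a \- b])); first by exists u, v.
move=> _ [a [b [sa sb ->]]]; split => [x|i x|i].
- exact: (cvgB (smooth_continuous sa (x := x)) (smooth_continuous sb (x := x))).
- by apply: derivableB; exact: smooth_derivable.
- exists (partial i a), (partial i b).
  by split; [exact: smooth_partial|exact: smooth_partial|exact: partialB].
Qed.

Definition coord_fun i : E -> R := fun x => x ord0 i.

Lemma is_derive_coord i j x :
  is_derive x (delta_mx ord0 j) (coord_fun i) (i == j)%:R.
Proof.
apply: DeriveDef.
  by apply: diff_derivable; exact: differentiable_coord.
rewrite /derive; apply: cvg_lim => //.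
apply: cvg_near_cst; near=> h.
have h0 : h != 0 by near: h; exact: nbhs_dnbhs_neq.
rewrite /= /coord_fun !mxE eqxx /= addrK.
by rewrite scalerA mulVf// scale1r.
Unshelve. all: by end_near.
Qed.

Lemma derivable_coordM i u j x : smooth u ->
  derivable (coord_fun i \* u) x (delta_mx ord0 j).
Proof.
move=> su; apply: derivableM; last exact: smooth_derivable.
exact: (@ex_derive _ _ _ _ _ _ _ (is_derive_coord i j x)).
Qed.

Lemma partial_coordM i u j : smooth u ->
  partial j (coord_fun i \* u) =
  (coord_fun i \* partial j u) \+ (fun x => (i == j)%:R * u x).
Proof.
move=> su; apply/funext => x.
have d := is_derive_coord i j x.
rewrite /partial [LHS](deriveM (@ex_derive _ _ _ _ _ _ _ d)); last first.
  exact: smooth_derivable.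
have -> : 'D_(delta_mx ord0 j) (coord_fun i) x = (i == j)%:R.
  exact: derive_val.
by congr (_ + _); exact: mulrC.
Qed.

(** The functions [x_i a - b] with [a] and [b] smooth are stable under
    [partial]: [d_j (x_i a - b) = x_i d_j a - (d_j b - delta_ij a)]. *)
Lemma smooth_coordM i u : smooth u -> smooth (coord_fun i \* u).
Proof.
move=> su; apply: (@smooth_ind (fun w => exists a b,
  [/\ smooth a, smooth b & w = (coord_fun i \* a) \- b])).
  exists u, (u \- u); split; [exact: su|exact: smoothB|].
  by apply/funext => x /=; rewrite subrr subr0.
move=> _ [a [b [sa sb ->]]]; split => [x|j x|j].
- have ca : continuous (coord_fun i \* a).
    move=> y; exact: (cvgM (@coord_continuous _ _ _ ord0 i y)
      (smooth_continuous sa (x := y))).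
  exact: (cvgB (ca x) (smooth_continuous sb (x := x))).
- apply: derivableB; last exact: smooth_derivable.
  exact: derivable_coordM.
- have E : partial j ((coord_fun i \* a) \- b) =
      (coord_fun i \* partial j a) \- 
      (partial j b \- (fun x => (i == j)%:R * a x)).
    apply/funext => x; have ea := congr1 (@^~ x) (partial_coordM i j sa).
    rewrite /partial deriveB;
      [|exact: derivable_coordM|exact: smooth_derivable].
    by rewrite /= opprB addrA; congr (_ - _); exact: ea.
  have [ij|ij] := eqVneq i j.
    exists (partial j a), (partial j b \- a); split.
    + exact: smooth_partial.
    + by apply: smoothB; [exact: smooth_partial|exact: sa].
    + by rewrite E; apply/funext => x /=; rewrite ij eqxx mul1r.
  exists (partial j a), (partial j b); split; try exact: smooth_partial.
  by rewrite E; apply/funext => x /=; rewrite (negbTE ij) mul0r subr0.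
Qed.

Lemma test_functionB Omega phi psi :
  test_function Omega phi -> test_function Omega psi ->
  test_function Omega (phi \- psi).
Proof.
move=> [sp cp pO] [sq cq qO].
have sub : closure [set x | (phi \- psi) x != 0] `<=`
    closure [set x | phi x != 0] `|` closure [set x | psi x != 0].
  rewrite -closureU; apply: closure_subset => x /= H.
  apply/orP; move: H; apply: contraNT; rewrite negb_or !negbK.
  by move=> /andP[/eqP-> /eqP->]; rewrite subrr.
split; first exact: smoothB.
  apply: subclosed_compact sub; first exact: closed_closure.
  exact: compactU.
by apply: subset_trans sub _; rewrite subUset.
Qed.

Lemma test_function_coordM Omega phi i :
  test_function Omega phi -> test_function Omega (coord_fun i \* phi).
Proof.
move=> [sp cp pO].
have sub : closure [set x | (coord_fun i \* phi) x != 0] `<=`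
    closure [set x | phi x != 0].
  by apply: closure_subset => x /=; rewrite mulf_eq0 negb_or => /andP[].
split; first exact: smooth_coordM.
  by apply: subclosed_compact sub => //; exact: closed_closure.
exact: subset_trans sub _.
Qed.

Lemma bounded_closure Omega : bounded_set Omega -> bounded_set (closure Omega).
Proof.
move=> [M [Mr HM]]; exists M; split => // y My.
have cl : closed [set x : E | `|x| <= y].
  apply: (@closed_comp _ _ (fun x : E => `|x|) [set r | r <= y]).
    by move=> x _; exact: norm_continuous.
  exact: closed_le.
suff : closure Omega `<=` [set x : E | `|x| <= y] by [].
rewrite [X in _ `<=` X]((closure_id _).1 cl).
by apply: closure_subset => x; exact: HM.
Qed.

Lemma continuous_bounded Omega u : bounded_set Omega -> continuous u ->
  [bounded u x | x in Omega].
Proof.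
move=> bO cu.
have cO : compact (closure Omega).
  apply: bounded_closed_compact; last exact: closed_closure.
  exact: bounded_closure.
have /compact_bounded : compact (u @` closure Omega).
  by apply: continuous_compact => //; exact: continuous_subspaceT.
move=> [M [Mr HM]]; exists M; split => // y My x Ox.
by apply: (HM y My); exists x => //; exact: subset_closure.
Qed.

End test_functions.

(** * Square-integrable functions *)

Section sobolev.
Context {R : realType} {N : nat}.
Local Notation E := 'rV[R]_N.
Local Notation mu := (@lebesgue_rV R N).
Implicit Types (Omega : set E) (u v w f g phi psi : E -> R)
  (Du Dv Dw : 'I_N -> E -> R) (i j : 'I_N).

Lemma integrable_EFin_le Omega f g : measurable Omega ->
  measurable_fun Omega f -> (forall x, `|f x| <= g x) ->
  mu.-integrable Omega (EFin \o g) -> mu.-integrable Omega (EFin \o f).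
Proof.
move=> mO mf fg ig; apply: le_integrable ig => //.
  exact/measurable_EFinP.
by move=> x _ /=; rewrite lee_fin (le_trans (fg x))// ler_norm.
Qed.

(** The integral is the difference of those of the positive and negative parts,
    computed in the extended reals; if one of the two were infinite, so would
    be the difference. *)
Lemma integrable_fin_integral Omega f : measurable Omega ->
  measurable_fun Omega f ->
  (\int[mu]_(x in Omega) (f x)%:E)%E \is a fin_num ->
  mu.-integrable Omega (EFin \o f).
Proof.
move=> mO mf.
have mF : measurable_fun Omega (EFin \o f) by exact/measurable_EFinP.
rewrite integralE => fin.
have p0 : (0 <= \int[mu]_(x in Omega) ((EFin \o f)^\+ x))%E.
  exact: integral_ge0.
have n0 : (0 <= \int[mu]_(x in Omega) ((EFin \o f)^\- x))%E.
  exact: integral_ge0.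
have [pF nF] : (\int[mu]_(x in Omega) ((EFin \o f)^\+ x) < +oo)%E /\
    (\int[mu]_(x in Omega) ((EFin \o f)^\- x) < +oo)%E.
  by move: fin p0 n0; do 2 case: (integral _ _ _) => [?| |]//=; rewrite ?ltry.
rewrite (funeposneg (EFin \o f)); apply: integrableB => //;
  apply/integrableP; split.
- exact: measurable_funepos.
- by under eq_integral do rewrite gee0_abs//.
- exact: measurable_funeneg.
- by under eq_integral do rewrite gee0_abs//.
Qed.

Lemma in_L2_sqr_integrable Omega u :
  in_L2 Omega u -> mu.-integrable Omega (EFin \o (fun x => u x ^+ 2)).
Proof.
move=> [mu_ iu]; apply/integrableP; split.
  by apply/measurable_EFinP; exact: measurable_funX.
by under eq_integral do rewrite /= ger0_norm ?sqr_ge0//.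
Qed.

Lemma in_L2M_integrable Omega u v : measurable Omega ->
  in_L2 Omega u -> in_L2 Omega v ->
  mu.-integrable Omega (EFin \o (fun x => u x * v x)).
Proof.
move=> mO Lu Lv.
apply: (@integrable_EFin_le _ _ (fun x => u x ^+ 2 + v x ^+ 2)) => //.
- by apply: measurable_funM; [case: Lu|case: Lv].
- by move=> x; rewrite ler_norml; apply/andP; split; nra.
- exact: (integrableD mO (in_L2_sqr_integrable Lu) (in_L2_sqr_integrable Lv)).
Qed.

Lemma in_L2_of_integrable Omega u : measurable_fun Omega u ->
  mu.-integrable Omega (EFin \o (fun x => u x ^+ 2)) -> in_L2 Omega u.
Proof.
move=> mf /integrableP[_]; split => //; move: b.
by under eq_integral do rewrite /= ger0_norm ?sqr_ge0//.
Qed.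

Lemma sqrB_le (a b : R) : (a - b) ^+ 2 <= a ^+ 2 + b ^+ 2 + (a ^+ 2 + b ^+ 2).
Proof.
rewrite -subr_ge0 (_ : _ - _ = (a + b) ^+ 2) ?sqr_ge0//; ring.
Qed.
Lemma in_L2B Omega u v : measurable Omega ->
  in_L2 Omega u -> in_L2 Omega v -> in_L2 Omega (u \- v).
Proof.
move=> mO Lu Lv; have mB : measurable_fun Omega (u \- v).
  by apply: measurable_funB; [case: Lu|case: Lv].
apply: in_L2_of_integrable => //.
apply: (@integrable_EFin_le _ _
  (fun x => (u x ^+ 2 + v x ^+ 2) + (u x ^+ 2 + v x ^+ 2))) => //.
- exact: measurable_funX.
- by move=> x /=; rewrite ger0_norm ?sqr_ge0// sqrB_le.
- have iS : mu.-integrable Omega (EFin \o (fun x => u x ^+ 2 + v x ^+ 2)).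
    exact: (integrableD mO (in_L2_sqr_integrable Lu) (in_L2_sqr_integrable Lv)).
  exact: (integrableD mO iS iS).
Qed.

Lemma in_L2_bounded Omega u : measurable Omega -> bounded_set Omega ->
  measurable_fun Omega u -> [bounded u x | x in Omega] -> in_L2 Omega u.
Proof.
move=> mO bO mf bf; apply: in_L2_of_integrable => //.
apply: measurable_bounded_integrable => //.
- exact: bounded_measure_lty.
- exact: measurable_funX.
- have [M [Mr HM]] := bf; exists ((`|M| + 1) ^+ 2).
  split; first exact: num_real.
  move=> y My x Ox /=; rewrite normrX (le_trans _ (ltW My))//.
  rewrite ler_pXn2r ?nnegrE//.
  by apply: HM => //; rewrite ltr_pwDr// ler_norm.
Qed.

Lemma continuous_in_L2 Omega u : measurable Omega -> bounded_set Omega ->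
  continuous u -> in_L2 Omega u.
Proof.
move=> mO bO cu; apply: in_L2_bounded => //.
  by apply: measurable_funTS; exact: continuous_measurable_rV.
exact: continuous_bounded.
Qed.

Lemma test_function_in_L2 Omega phi : measurable Omega -> bounded_set Omega ->
  test_function Omega phi ->
  in_L2 Omega phi /\ forall i, in_L2 Omega (partial i phi).
Proof.
move=> mO bO [sp _ _]; split => [|i]; apply: continuous_in_L2 => //.
  exact: smooth_continuous.
by apply: smooth_continuous; exact: smooth_partial.
Qed.

Lemma integralB_real Omega f g : measurable Omega ->
  mu.-integrable Omega (EFin \o f) -> mu.-integrable Omega (EFin \o g) ->
  (\int[mu]_(x in Omega) (f x - g x)%:E =
   \int[mu]_(x in Omega) (f x)%:E - \int[mu]_(x in Omega) (g x)%:E)%E.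
Proof.
move=> mO mf mg; under eq_integral do rewrite EFinB.
exact: integralB_EFin.
Qed.

(** * Weak gradients and H^1_0 *)

Lemma weak_gradientB Omega u v Du Dv : measurable Omega -> bounded_set Omega ->
  in_L2 Omega u -> in_L2 Omega v ->
  weak_gradient Omega u Du -> weak_gradient Omega v Dv ->
  weak_gradient Omega (u \- v) (fun i => Du i \- Dv i).
Proof.
move=> mO bO Lu Lv [LDu wu] [LDv wv]; split => [i|i phi tp].
  exact: in_L2B.
have [Lp Ldp] := test_function_in_L2 mO bO tp.
under eq_integral do rewrite /= mulrBl.
rewrite integralB_real//; [|exact: in_L2M_integrable|exact: in_L2M_integrable].
rewrite wu// wv//.
under [in RHS]eq_integral do rewrite /= mulrBl.
rewrite integralB_real//; [|exact: in_L2M_integrable|exact: in_L2M_integrable].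
have F := integrable_fin_num mO (in_L2M_integrable mO (LDv i) Lp).
by rewrite fin_num_oppeB// oppeK.
Qed.

Lemma sumM_integrable Omega Du Dv : measurable Omega ->
  (forall i, in_L2 Omega (Du i)) -> (forall i, in_L2 Omega (Dv i)) ->
  mu.-integrable Omega (EFin \o (fun x => \sum_i Du i x * Dv i x)).
Proof.
move=> mO LD LD'.
rewrite (_ : _ \o _ =
    fun x => (\sum_i (EFin \o (fun x => (Du i x * Dv i x)%R)) x)%E).
  by apply: integrable_sum => // i _; exact: in_L2M_integrable.
by apply/funext => x /=; rewrite sumEFin.
Qed.

Lemma sqr_H1_integrable Omega u Du : measurable Omega ->
  in_L2 Omega u -> (forall i, in_L2 Omega (Du i)) ->
  mu.-integrable Omega (EFin \o (fun x => u x ^+ 2 + \sum_i Du i x ^+ 2)).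
Proof.
move=> mO Lu LD; under eq_fun do under eq_bigr do rewrite expr2.
exact: (integrableD mO (in_L2_sqr_integrable Lu) (sumM_integrable mO LD LD)).
Qed.

Lemma sqr_H1_normB_le Omega u v Du Dv : measurable Omega ->
  in_L2 Omega u -> in_L2 Omega v ->
  (forall i, in_L2 Omega (Du i)) -> (forall i, in_L2 Omega (Dv i)) ->
  (sqr_H1_norm Omega (u \- v)%R (fun i => Du i \- Dv i)%R <=
   (sqr_H1_norm Omega u Du + sqr_H1_norm Omega v Dv) +
   (sqr_H1_norm Omega u Du + sqr_H1_norm Omega v Dv))%E.
Proof.
move=> mO Lu Lv LDu LDv.
have iu := sqr_H1_integrable mO Lu LDu; have iv := sqr_H1_integrable mO Lv LDv.
have iuv := integrableD mO iu iv.
rewrite /sqr_H1_norm -(integralD mO iu iv) -(integralD mO iuv iuv).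
apply: le_integral => //.
- apply: sqr_H1_integrable => // [|i]; exact: in_L2B.
- exact: (integrableD mO iuv iuv).
move=> x _ /=; rewrite -!EFinD lee_fin.
rewrite [leRHS](_ : _ = (u x ^+ 2 + v x ^+ 2 + (u x ^+ 2 + v x ^+ 2)) +
    \sum_i (Du i x ^+ 2 + Dv i x ^+ 2 + (Du i x ^+ 2 + Dv i x ^+ 2)));
  last by rewrite !big_split /=; ring.
by apply: lerD => [|]; [|apply: ler_sum => i _]; exact: sqrB_le.
Qed.

(** One gradient serves both as the weak gradient and as the limit of the
    gradients of the approximations. Naming it makes the proof independent of
    the uniqueness of weak gradients. *)
Definition H10_gradient Omega u Du :=
  weak_gradient Omega u Du /\
  exists2 phi : nat -> E -> R, (forall n, test_function Omega (phi n)) &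
    (fun n => sqr_H1_norm Omega (u \- phi n)
                (fun i => Du i \- partial i (phi n))) @ \oo --> 0%E.

Lemma in_H10P Omega u :
  in_H10 Omega u <-> in_L2 Omega u /\ exists Du, H10_gradient Omega u Du.
Proof. by []. Qed.

Lemma H10_gradientB Omega u v Du Dv : measurable Omega -> bounded_set Omega ->
  in_L2 Omega u -> in_L2 Omega v ->
  H10_gradient Omega u Du -> H10_gradient Omega v Dv ->
  H10_gradient Omega (u \- v) (fun i => Du i \- Dv i).
Proof.
move=> mO bO Lu Lv [wu [phi tp cphi]] [wv [psi tq cpsi]].
split; first exact: weak_gradientB.
exists (fun n => phi n \- psi n); first by move=> n; exact: test_functionB.
pose su n := sqr_H1_norm Omega (u \- phi n)
  (fun i => Du i \- partial i (phi n)).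
pose sv n := sqr_H1_norm Omega (v \- psi n)
  (fun i => Dv i \- partial i (psi n)).
apply: (@squeeze_cvge _ _ _ _ (cst 0%E) _
  (fun n => (su n + sv n) + (su n + sv n))%E).
- apply: nearW => n /=; apply/andP; split.
    apply: integral_ge0 => x _; rewrite lee_fin addr_ge0 ?sqr_ge0//.
    by rewrite sumr_ge0// => i _; exact: sqr_ge0.
  have [Lp Ldp] := test_function_in_L2 mO bO (tp n).
  have [Lq Ldq] := test_function_in_L2 mO bO (tq n).
  have [sp _ _] := tp n; have [sq _ _] := tq n.
  have [LDu _] := wu; have [LDv _] := wv.
  rewrite [leLHS](_ : _ = sqr_H1_norm Omega ((u \- phi n) \- (v \- psi n))
    (fun i => (Du i \- partial i (phi n)) \- (Dv i \- partial i (psi n)))).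
    by apply: sqr_H1_normB_le => // [||i|i]; exact: in_L2B.
  congr (sqr_H1_norm _ _ _).
    by apply/funext => x /=; ring.
  apply/funext => i; rewrite partialB//; apply/funext => x /=; ring.
- exact: cvg_cst.
- have c : (fun n => su n + sv n)%E @ \oo --> 0%E.
    have dd : ((0 : \bar R) +? 0)%E by [].
    have := cvgeD dd cphi cpsi; rewrite adde0; exact.
  have dd : ((0 : \bar R) +? 0)%E by [].
  have := cvgeD dd c c; rewrite adde0; exact.
Qed.

(** * Poincare inequality *)

(** Here [e] and [d] are the errors of the approximations [w - e] of [w] and
    [D - d] of [D]. With [y = x D] and [z = x d], the first summand is
    [2 w^2 - 2 w e + 4 w y - 2 w z - 2 y e], and the claim with [M = |x|]
    holds because the difference of its sides is
    [(w - e + 2 y - z)^2 + (e + y)^2 + (e - z)^2 + 2 (y + z)^2], plus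
    nonnegative multiples of squares. *)
Lemma poincare_pointwise (M x w D e d : R) : `|x| <= M ->
  w ^+ 2 <= 2 * (w * (x * (D - d) + (w - e)) + D * (x * (w - e))) +
    (9 * M ^+ 2 * D ^+ 2 + (5 + 4 * M ^+ 2) * (e ^+ 2 + d ^+ 2)).
Proof.
move=> xM; have x2 : x ^+ 2 <= M ^+ 2.
  by rewrite -real_normK ?num_real// ler_pXn2r ?nnegrE// (le_trans _ xM).
have D2 := ler_wpM2r (sqr_ge0 D) x2; have d2 := ler_wpM2r (sqr_ge0 d) x2.
have := sqr_ge0 (w - e + 2 * (x * D) - x * d).
have := sqr_ge0 (e + x * D); have := sqr_ge0 (e - x * d).
have := sqr_ge0 (x * D + x * d); have := sqr_ge0 e; have := sqr_ge0 (x * D).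
have := mulr_ge0 (sqr_ge0 M) (sqr_ge0 e); have := sqr_ge0 d.
nra.
Qed.

(** Integrating [poincare_pointwise] kills the first summand, since the test
    function [x_i phi_n] has derivative [phi_n + x_i d_i phi_n]; the errors
    vanish in the limit. *)
Lemma poincare Omega w Dw i (M : R) : measurable Omega -> bounded_set Omega ->
  (forall x, Omega x -> `|x ord0 i| <= M) ->
  in_L2 Omega w -> H10_gradient Omega w Dw ->
  (\int[mu]_(x in Omega) (w x ^+ 2)%:E <=
   (9 * M ^+ 2)%:E * \int[mu]_(x in Omega) (Dw i x ^+ 2)%:E)%E.
Proof.
move=> mO bO OM Lw [[LD wD] [phi tp cphi]].
set B := (X in (_ * X)%E).
pose s n := sqr_H1_norm Omega (w \- phi n) (fun i => Dw i \- partial i (phi n)).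
have step n : (\int[mu]_(x in Omega) (w x ^+ 2)%:E <=
    (9 * M ^+ 2)%:E * B + (5 + 4 * M ^+ 2)%:E * s n)%E.
  have tc := test_function_coordM i (tp n).
  have [Lc Ldc] := test_function_in_L2 mO bO tc.
  have [Lp Ldp] := test_function_in_L2 mO bO (tp n).
  have i1 := in_L2M_integrable mO Lw (Ldc i).
  have i2 := in_L2M_integrable mO (LD i) Lc.
  have i12 := integrableD mO i1 i2.
  have iD := in_L2_sqr_integrable (LD i).
  have i3 : mu.-integrable Omega (EFin \o (fun x => (w \- phi n) x ^+ 2 +
      \sum_j (Dw j \- partial j (phi n)) x ^+ 2)).
    by apply: sqr_H1_integrable => // [|j]; exact: in_L2B.
  have I0 : (\int[mu]_(x in Omega) (w x * partial i (coord_fun i \* phi n) x +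
      Dw i x * (coord_fun i \* phi n) x)%:E = 0)%E.
    have F := integrable_fin_num mO i2.
    by rewrite [LHS](integralD mO i1 i2) /= wD// addeC subee.
  have iR := integrableD mO (integrableZl mO 2 i12)
    (integrableD mO (integrableZl mO (9 * M ^+ 2) iD)
                    (integrableZl mO (5 + 4 * M ^+ 2) i3)).
  (* the zero integral I0 takes part in the integrated inequality *)
  rewrite (_ : (_ + _)%E = (2%:E * 0 + ((9 * M ^+ 2)%:E * B +
    (5 + 4 * M ^+ 2)%:E * s n))%E); last by rewrite mule0 add0e.
  rewrite -I0 /s /B /sqr_H1_norm.
  rewrite -(integralZl mO i12) -(integralZl mO iD) -(integralZl mO i3).
  rewrite -integralD//; [|exact: integrableZl|exact: integrableZl].
  rewrite -integralD//; [|exact: integrableZl|]; last first.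
    by apply: integrableD => //; exact: integrableZl.
  apply: le_integral => //; first exact: in_L2_sqr_integrable.
  move=> x; rewrite inE => Ox /=; rewrite -!EFinM -!EFinD lee_fin.
  have [sp _ _] := tp n.
  have -> : partial i (coord_fun i \* phi n) x =
      x ord0 i * partial i (phi n) x + phi n x.
    by rewrite partial_coordM//= eqxx mul1r.
  have := poincare_pointwise (w x) (Dw i x) (w x - phi n x)
    (Dw i x - partial i (phi n) x) (OM x Ox).
  rewrite !subKr => /le_trans; apply; rewrite lerD2l lerD2l.
  apply: ler_wpM2l; first by rewrite addr_ge0// mulr_ge0// sqr_ge0.
  rewrite lerD2l (bigD1 i)//= lerDl sumr_ge0// => j _; exact: sqr_ge0.
have : (fun n => (9 * M ^+ 2)%:E * B + (5 + 4 * M ^+ 2)%:E * s n)%E @ \oo -->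
   ((9 * M ^+ 2)%:E * B + (5 + 4 * M ^+ 2)%:E * 0)%E.
  apply: cvgeD; [by rewrite mule0 fin_num_adde_defl|exact: cvg_cst|].
  exact: cvgeZl.
by rewrite mule0 adde0 => c; apply: (cvge_ge _ c); exact: nearW.
Qed.

End sobolev.

(** * Uniqueness *)

Lemma powR_odd_monotone (R : realType) (p a b : R) : 0 <= p ->
  (`|a| `^ p * a - `|b| `^ p * b) * (b - a) <= 0.
Proof.
move=> p0; wlog ab : a b / a <= b.
  move=> H; have [/H//|/ltW/H] := leP a b.
  by rewrite -mulrNN !opprB.
apply: mulr_le0_ge0; last by rewrite subr_ge0.
rewrite subr_le0.
have pow (x y : R) : 0 <= x -> x <= y -> x `^ p * x <= y `^ p * y.
  move=> x0 xy; have y0 := le_trans x0 xy.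
  by apply: ler_pM => //; [exact: powR_ge0|exact: ge0_ler_powR].
have [a0|a0] := leP 0 a.
  by rewrite (ger0_norm a0) (ger0_norm (le_trans a0 ab)) pow.
have [b0|b0] := leP 0 b.
  apply: (@le_trans _ _ 0); last by rewrite mulr_ge0// powR_ge0.
  by rewrite mulr_ge0_le0// ?powR_ge0// ltW.
rewrite (ltr0_norm a0) (ltr0_norm b0) -lerN2 -!mulrN pow ?lerN2//.
by rewrite oppr_ge0 ltW.
Qed.

Lemma measurable_weighted_power (R : realType) N (Omega : set 'rV[R]_N)
    (beta p : R) (u : 'rV[R]_N -> R) : measurable_fun Omega u ->
  measurable_fun Omega
    (fun x => eucl_norm x `^ beta * (`|u x| `^ p * u x)).
Proof.
move=> mf; apply: measurable_funM.
  apply: measurable_funTS.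
  apply: (measurableT_comp (measurable_powR beta)).
  apply: (measurableT_comp (f := @Num.sqrt R)).
    apply: continuous_measurable_fun; exact: sqrt_continuous.
  by apply: measurable_sum => i; apply: measurable_funX;
    exact: measurable_coord.
apply: measurable_funM => //.
apply: (measurableT_comp (measurable_powR p)).
exact: measurableT_comp mf.
Qed.

Lemma integral_sqr_le0_ae (R : realType) N (Omega : set 'rV[R]_N)
    (w : 'rV[R]_N -> R) : measurable Omega -> measurable_fun Omega w ->
  (\int[lebesgue_rV N]_(x in Omega) (w x ^+ 2)%:E <= 0)%E ->
  {ae lebesgue_rV N, forall x, Omega x -> w x = 0}.
Proof.
move=> mO mw w0.
have : (\int[lebesgue_rV N]_(x in Omega) `|(w x ^+ 2)%:E| = 0)%E.
  under eq_integral do rewrite gee0_abs ?lee_fin ?sqr_ge0//.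
  apply/eqP; rewrite eq_le w0/=; apply: integral_ge0 => x _.
  by rewrite lee_fin sqr_ge0.
move/(ae_eq_integral_abs _ mO) => H.
have {}H := H ltac:(by apply/measurable_EFinP; exact: measurable_funX).
apply: filterS H => x H /H /=.
by move/eqP; rewrite eqe sqrf_eq0 => /eqP.
Qed.

Theorem theorem1p5 (R : realType) (N : nat) (Omega : set 'rV[R]_N)
    (beta q : R) (u v : 'rV[R]_N -> R) :
  (1 <= N)%N ->
  bounded_domain Omega ->
  0 <= beta ->
  1 < q ->
  ((3 <= N)%N -> q + 1 <= 2 * N%:R / (N%:R - 2)) ->
  weak_solution Omega u
    (fun x => eucl_norm x `^ beta * (`|v x| `^ (q - 1) * v x)) ->
  weak_solution Omega v
    (fun x => eucl_norm x `^ beta * (`|u x| `^ (q - 1) * u x)) ->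
  {ae lebesgue_rV N, forall x, Omega x -> u x = v x}.
Proof.
move=> N1 [oO _ _ bO] _ q1 _ [H10u eq_u] [H10v eq_v].
have mO := open_measurable_rV oO.
have /in_H10P[Lu [Du gu]] := H10u; have /in_H10P[Lv [Dv gv]] := H10v.
have Lw := in_L2B mO Lu Lv.
have gw := H10_gradientB mO bO Lu Lv gu gv.
set w := u \- v in Lw gw; set Dw := (fun i => _) in gw.
have H10w : in_H10 Omega w by apply/in_H10P; split => //; exists Dw.
have [wgu _] := gu; have [wgv _] := gv; have [wgw _] := gw.
have [LDu _] := wgu; have [LDv _] := wgv; have [LDw _] := wgw.
have {}eq_u := eq_u _ wgu _ _ H10w wgw.
have {}eq_v := eq_v _ wgv _ _ H10w wgw.
have iu := sumM_integrable mO LDu LDw; have iv := sumM_integrable mO LDv LDw.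
have mw : measurable_fun Omega w by case: Lw.
have ifu : (lebesgue_rV N).-integrable Omega (EFin \o (fun x =>
    eucl_norm x `^ beta * (`|v x| `^ (q - 1) * v x) * w x)).
  apply: integrable_fin_integral => //.
    by apply: measurable_funM => //; apply: measurable_weighted_power; case: Lv.
  by rewrite -eq_u; exact: (integrable_fin_num mO iu).
have ifv : (lebesgue_rV N).-integrable Omega (EFin \o (fun x =>
    eucl_norm x `^ beta * (`|u x| `^ (q - 1) * u x) * w x)).
  apply: integrable_fin_integral => //.
    by apply: measurable_funM => //; apply: measurable_weighted_power; case: Lu.
  by rewrite -eq_v; exact: (integrable_fin_num mO iv).
have Dw0 :
    (\int[lebesgue_rV N]_(x in Omega) (\sum_i Dw i x * Dw i x)%:E <= 0)%E.
  rewrite (_ : (\int[_]_(x in _) _ = \int[lebesgue_rV N]_(x in Omega)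
    (\sum_i Du i x * Dw i x - \sum_i Dv i x * Dw i x)%:E)%E); last first.
    apply: eq_integral => x _; congr EFin; rewrite -sumrB.
    by apply: eq_bigr => i _; rewrite -mulrBl.
  rewrite integralB_real// eq_u eq_v -integralB_real//.
  rewrite -[leRHS](integral0 (lebesgue_rV N) Omega).
  apply: le_integral => //.
  - exact: (integrableB mO ifu ifv).
  - exact: integrable0.
  move=> x _; rewrite lee_fin -mulrBl -mulrBr -mulrA mulr_ge0_le0 ?powR_ge0//.
  by apply: powR_odd_monotone; rewrite subr_ge0 ltW.
have [M OM] := bounded_coord bO.
pose i0 : 'I_N := Ordinal N1.
have w0 : (\int[lebesgue_rV N]_(x in Omega) (w x ^+ 2)%:E <= 0)%E.
  apply: le_trans (poincare mO bO (fun x Ox => OM x i0 Ox) Lw gw) _.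
  apply: mule_ge0_le0; first by rewrite lee_fin mulr_ge0// sqr_ge0.
  apply: le_trans Dw0; apply: le_integral => //.
  - exact: in_L2_sqr_integrable (LDw i0).
  - exact: sumM_integrable.
  move=> x _; rewrite lee_fin (bigD1 i0)//= expr2 lerDl sumr_ge0// => j _.
  by rewrite -expr2 sqr_ge0.
have := integral_sqr_le0_ae mO mw w0.
by apply: filterS => x H /H /eqP; rewrite subr_eq0 => /eqP.
Qed.
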